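(* The largest universal constant $c$ for which $$\Delta(G)-\rho(G)>\frac{c}{|V(G)|\operatorname{diam}(G)}$$ holds for every finite connected nonregular simple graph $G$ is $c=1$. There is a sequence $(G_h)$ of finite connected simple graphs, each with one vertex of degree two and all other vertices of degree three, such that $$|V(G_h)|\operatorname{diam}(G_h)\,(3-\rho(G_h))\longrightarrow1.$$
   Context: $\Delta(G)$ is the maximum degree, $\rho(G)$ the spectral radius of the adjacency matrix, and $\operatorname{diam}(G)$ the diameter of $G$. *)

(* Defs.v *)
From HB Require Import structures.
From mathcomp Require Import all_boot all_order all_algebra.
From mathcomp Require Import all_classical all_reals all_analysis.
From mathcomp Require Import complex.
Import Order.TTheory GRing.Theory Num.Theory.
Import numFieldNormedType.Exports.

Set Implicit Arguments.
Unset Strict Implicit.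
Unset Printing Implicit Defensive.

Local Open Scope classical_set_scope.
Local Open Scope ring_scope.

Record sgraph := SGraph {
  vertex :> finType;
  adj : rel vertex;
  adj_sym : symmetric adj;
  adj_irrefl : irreflexive adj }.

Section Graph.
Variable G : sgraph.
Implicit Types x y : G.

Definition degree x : nat := #|[set y | adj x y]%SET|.

Definition max_degree : nat := \max_(x : G) degree x.

Definition regular : Prop := exists d : nat, forall x, degree x = d.

(* The graph without vertices is not connected. *)
Definition connected_graph : Prop :=
  (0 < #|G|)%N /\ forall x y, connect (@adj G) x y.

Definition has_walk x y (n : nat) : bool :=
  [exists p : n.-tuple G, path (@adj G) x p && (last x p == y)].

(* The least length of a walk from x to y. In a connected graph this length is
   less than #|G|, so the search below succeeds; the value is #|G| when there
   is no walk at all. *)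
Definition distance x y : nat := find (has_walk x y) (iota 0 #|G|).

Definition diam : nat := \max_(x : G) \max_(y : G) distance x y.

Definition adjacency_mx (R : nzRingType) : 'M[R]_#|G| :=
  \matrix_(i, j) (adj (enum_val i) (enum_val j))%:R.

End Graph.

Definition spectral_radius (R : realType) (n : nat) (A : 'M[R]_n) : R :=
  sup [set ComplexField.Normc.normc a |
        a in [set a : R[i] | eigenvalue (map_mx (real_complex R) A) a]].

Definition graph_spectral_radius (R : realType) (G : sgraph) : R :=
  spectral_radius (adjacency_mx G R).

Definition gap_constant (R : realType) (c : R) : Prop :=
  forall G : sgraph, connected_graph G -> ~ regular G ->
    (max_degree G)%:R - graph_spectral_radius R G > c / (#|G| * diam G)%:R.

Definition one_degree2_rest_degree3 (G : sgraph) : Prop :=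
  exists v : G, degree v = 2%N /\ forall w : G, w != v -> degree w = 3%N.

(* Main.v *)
(** Lower bound: if [v] is an eigenvector for [a], then [y = |v|] satisfies [Delta y - A y <= mu y]
with [mu = Delta - |a|]. Normalize [max y = y s = 1], let [u] have degree below [Delta], let [n] and
[D] be the order and the diameter, and suppose [mu n D <= 1]. Summing the inequalities gives
[y u <= mu n <= 1/D]; the inequality at [s] gives [y w >= 1 - mu] at every neighbour [w] of [s], so
some [w] within distance [D - 1] of [u] has [y w >= 1 - mu]. For [D >= 3], Cauchy-Schwarz along a
shortest path from [w] to [u] gives [(1 - mu)^2 <= D mu sum y^2 <= D mu (n - 1 + y u ^ 2)], which is
impossible; for [D = 2] the inequality at [w] already forces [y u >= 1 - (Delta + 1) mu].

Sharpness: hang a complete binary tree of depth [k] at the end of a spine of [l] bridges, make all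
other degrees three by attaching bounded gadgets, and take as test function the one that grows by
one along each spine edge and is constant across every other edge. Its Rayleigh quotient gives
[3 - rho <= 1 / (N (l + 1))], where [N >= 2^k] is the order of the tree part, while [n = N + 6 l]
and [D <= l + 2 k + 10]; then choose [k << l << 2^k]. *)
Require Import Defs.
From HB Require Import structures.
From mathcomp Require Import all_boot all_order all_algebra.
From mathcomp Require Import all_classical all_reals all_analysis.
From mathcomp Require Import complex.
Import Order.TTheory GRing.Theory Num.Theory.
Import numFieldNormedType.Exports.
From mathcomp Require Import spectral ring lra zify.

Set Implicit Arguments.
Unset Strict Implicit.
Unset Printing Implicit Defensive.

Local Open Scope classical_set_scope.
Local Open Scope ring_scope.

Local Notation normc := ComplexField.Normc.normc.

(** * Spectral radius: attainment and the Rayleigh bound *)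

Lemma seq_argmax (R : realDomainType) (T : eqType) (F : T -> R) (s : seq T) :
  s != [::] -> exists2 x, x \in s & forall y, y \in s -> F y <= F x.
Proof.
elim: s => // a [|b s] IHs _.
  by exists a => [|y]; rewrite mem_seq1 // => /eqP ->.
have [x xs xmax] := IHs isT.
have [le_xa|lt_ax] := leP (F x) (F a).
  exists a => [|y]; rewrite ?mem_head // in_cons => /predU1P[->//|/xmax le_yx].
  exact: le_trans le_yx le_xa.
exists x => [|y]; first by rewrite in_cons xs orbT.
by rewrite in_cons => /predU1P[->|/xmax//]; exact: ltW.
Qed.

Section SpectralRadius.
Variables (R : realType) (n : nat) (A : 'M[R]_n).
Local Notation AC := (map_mx (real_complex R) A).

(** The characteristic polynomial splits over [R[i]], so the eigenvalues form a finite nonempty list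
    and the supremum of their moduli is a maximum. *)
Lemma spectral_radius_attained : (0 < n)%N ->
  exists2 a : R[i], eigenvalue AC a & spectral_radius A = normc a
    /\ forall b, eigenvalue AC b -> normc b <= normc a.
Proof.
move=> n_gt0.
have [rs char_rs] := closed_field_poly_normal (char_poly AC).
have eig_rs a : eigenvalue AC a = (a \in rs).
  rewrite eigenvalue_root_char char_rs rootZ ?root_prod_XsubC//.
  by rewrite lead_coef_eq0 monic_neq0 ?char_poly_monic.
have [a a_eig] := eigenvalue_closed AC n_gt0.
have rs_nil : rs != [::].
  by apply: contraTneq a_eig => rs_nil; rewrite eig_rs rs_nil.
have [m m_rs m_max] := seq_argmax (fun a : R[i] => normc a) rs_nil.
have m_eig : eigenvalue AC m by rewrite eig_rs.
exists m => //.
have le_m b : eigenvalue AC b -> normc b <= normc m by rewrite eig_rs => /m_max.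
split=> //; rewrite /spectral_radius; set S := (X in sup X).
have Sm : S (normc m) by exact: (ex_intro2 _ _ m m_eig erefl).
have ubS : ubound S (normc m) by move=> _ [b b_eig <-]; exact: le_m.
apply/eqP; rewrite eq_le (@ge_sup _ S (normc m)) //=; last by exists (normc m).
by apply: ub_le_sup; first by exists (normc m).
Qed.

Lemma normr_normc (z : R[i]) : `|z| = real_complex R (normc z).
Proof. by []. Qed.

Lemma eigenvalue_le_spectral_radius (a : R[i]) : (0 < n)%N ->
  eigenvalue AC a -> normc a <= spectral_radius A.
Proof. by move=> /spectral_radius_attained[m _ [-> m_max]] /m_max. Qed.

(** Over [R[i]] a real symmetric matrix is normal, hence unitarily diagonalizable; in the new
    coordinates the form is a sum of [d i * |z i|^2] with each [|d i|] at most the spectral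
    radius. *)
Lemma rayleigh_le_spectral_radius (x : 'rV[R]_n) : (0 < n)%N -> A^T = A ->
  (x *m A *m x^T) 0 0 <= spectral_radius A * (x *m x^T) 0 0.
Proof.
move=> n_gt0 symA.
pose toC := real_complex R.
have conj_real k l (B : 'M[R]_(k, l)) :
  map_mx Num.conj (map_mx (real_complex R) B) = map_mx (real_complex R) B.
  by apply/matrixP => i j; rewrite !mxE; apply/eqP; rewrite eq_complex /= oppr0 !eqxx.
have symAC : AC^T = AC by rewrite map_trmx symA.
have normalA : AC \is normalmx.
  by apply/normalmxP; rewrite symAC conj_real.
have /orthomx_spectralP := normalA.
set P := spectralmx AC; set d := spectral_diag AC => specA.
have unitP : P \is unitarymx by apply: spectral_unitarymx.
have PP := unitarymxP unitP.
rewrite (invmx_unitary unitP) in specA.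
(* Row [i] of the unitary matrix [P] is an eigenvector for [d i]; it is nonzero because [P] is
   invertible. *)
have eig_d i : eigenvalue AC (d 0 i).
  apply/eigenvalueP; exists (row i P).
    rewrite specA -row_mul !mulmxA PP mul1mx row_mul row_diag_mx.
    by rewrite -scalemxAl -rowE.
  apply: contraTneq (spectral_unit AC) => Pi0.
  rewrite -row_free_unit -kermx_eq0; apply/rowV0Pn.
  exists (delta_mx 0 i).
    by apply/sub_kermxP; rewrite -rowE.
  apply/eqP => /matrixP/(_ 0 i); rewrite !mxE !eqxx => /eqP.
  by rewrite oner_eq0.
pose xC := map_mx (real_complex R) x.
pose z := xC *m (P ^t*)%sesqui.
have zE : map_mx Num.conj z^T = P *m xC^T.
  by rewrite /z trmx_mul map_mxM /= trmxCK -map_trmx conj_real map_trmx.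
have conjTE i : map_mx Num.conj z^T i 0 = Num.conj (z 0 i) by rewrite mxE mxE.
have quadE : toC ((x *m A *m x^T) 0 0) = \sum_i d 0 i * `|z 0 i| ^+ 2.
  have -> : toC ((x *m A *m x^T) 0 0) = (xC *m AC *m xC^T) 0 0.
    by rewrite map_trmx -!map_mxM [RHS]mxE.
  rewrite specA !mulmxA -/z -mulmxA -zE mul_mx_diag mxE.
  apply: eq_bigr => i _; rewrite mxE conjTE normCK.
  by rewrite mulrAC mulrC.
have normE : toC ((x *m x^T) 0 0) = \sum_i `|z 0 i| ^+ 2.
  have -> : toC ((x *m x^T) 0 0) = (z *m map_mx Num.conj z^T) 0 0.
    rewrite zE /z mulmxA -(mulmxA xC) -(invmx_unitary unitP) mulVmx ?spectral_unit//.
    by rewrite mulmx1 map_trmx -!map_mxM [RHS]mxE.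
  by rewrite mxE; apply: eq_bigr => i _; rewrite conjTE normCK.
suff : toC ((x *m A *m x^T) 0 0) <= toC (spectral_radius A) * toC ((x *m x^T) 0 0).
  by rewrite -rmorphM lecR.
rewrite quadE normE mulr_sumr.
have quad_real : \sum_i d 0 i * `|z 0 i| ^+ 2 \is Num.real.
  by rewrite -quadE; apply/complex_realP; exists ((x *m A *m x^T) 0 0).
apply: le_trans (real_ler_norm quad_real) _.
apply: le_trans (ler_norm_sum _ _ _) _; apply: ler_sum => i _.
rewrite normrM [X in _ * X]ger0_norm ?exprn_ge0//.
rewrite ler_wpM2r ?exprn_ge0// normr_normc lecR.
exact: eigenvalue_le_spectral_radius.
Qed.
End SpectralRadius.

(** * Walks, distance, diameter and degrees *)

Section Graph.
Variable G : sgraph.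
Implicit Types x y : G.

Lemma has_walkP x y n :
  reflect (exists p, [/\ path (@adj G) x p, last x p = y & size p = n]) (has_walk x y n).
Proof.
apply: (iffP existsP) => [[p /andP[px /eqP lp]]|[p [px lp /eqP sp]]].
  by exists p; rewrite size_tuple.
by exists (Tuple sp); rewrite /= px lp eqxx.
Qed.

Lemma has_walk0 x : has_walk x x 0.
Proof. by apply/has_walkP; exists [::]. Qed.

Lemma has_walk1 x y : adj x y -> has_walk x y 1.
Proof. by move=> xy; apply/has_walkP; exists [:: y]; rewrite /= xy. Qed.

Lemma has_walk_cat x y z m n :
  has_walk x y m -> has_walk y z n -> has_walk x z (m + n).
Proof.
move=> /has_walkP[p [px lp sp]] /has_walkP[q [qy lq sq]]; apply/has_walkP.
by exists (p ++ q); rewrite cat_path px lp qy last_cat lp lq size_cat sp sq.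
Qed.

Lemma has_walk_sym x y n : has_walk x y n -> has_walk y x n.
Proof.
move=> /has_walkP[p [px <- sp]]; apply/has_walkP; exists (rev (belast x p)).
rewrite rev_path size_rev size_belast sp; split=> //.
  by rewrite -(eq_path (e := @adj G)) // => u v; rewrite adj_sym.
by case: p {px sp} => //= z p; rewrite rev_cons last_rcons.
Qed.

Lemma distance_le x y n : has_walk x y n -> (distance x y <= n)%N.
Proof.
(* When [n] is at least the order, the default value of the search already gives the bound. *)
move=> xyn; rewrite /distance; have [nG|Gn] := ltnP n #|G|; last first.
  by apply: leq_trans Gn; rewrite -[leqRHS](size_iota 0) find_size.
rewrite leqNgt; apply/negP => /(before_find 0%N).
by rewrite nth_iota // add0n xyn.
Qed.

(** Removing loops from a path leaves distinct vertices, hence a length below the order, so the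
    search in [distance] succeeds. *)
Lemma distance_walk x y : connect (@adj G) x y -> has_walk x y (distance x y).
Proof.
move=> /connectP[p px ->]; case/shortenP: px => q qx uq _.
set y' := last x q.
have hq : has_walk x y' (size q) by apply/has_walkP; exists q.
have szq : (size q < #|G|)%N by rewrite -[_.+1]/(size (x :: q)) -(card_uniqP uq) max_card.
have hasq : has (has_walk x y') (iota 0 #|G|).
  by apply/hasP; exists (size q) => //; rewrite mem_iota.
have := nth_find 0%N hasq; rewrite nth_iota ?add0n //.
by move: hasq; rewrite has_find size_iota.
Qed.

Lemma distance_le_diam x y : (distance x y <= diam G)%N.
Proof.
rewrite /diam; apply: leq_trans (leq_bigmax x).
exact: (leq_bigmax (F := fun y => distance x y)).
Qed.

Lemma diam_le n :
  (forall x y, exists2 m, has_walk x y m & (m <= n)%N) -> (diam G <= n)%N.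
Proof.
move=> walks; apply/bigmax_leqP => x _; apply/bigmax_leqP => y _.
by have [m /distance_le xym] := walks x y; apply: leq_trans.
Qed.

Lemma degree_le_max x : (degree x <= max_degree G)%N.
Proof. exact: leq_bigmax. Qed.

Lemma degree_lt_card x : (degree x < #|G|)%N.
Proof.
rewrite /degree -cardsT; apply: proper_card; apply/properP; split.
  by apply/fintype.subsetP => y; rewrite inE.
by exists x; rewrite ?inE // adj_irrefl.
Qed.

Lemma max_degree_lt_card : (0 < #|G|)%N -> (max_degree G < #|G|)%N.
Proof.
move=> G_gt0; have [x] := bigop.eq_bigmax (@degree G) G_gt0.
by rewrite /max_degree => ->; exact: degree_lt_card.
Qed.

Lemma exists_deficient : ~ regular G -> exists u : G, (degree u < max_degree G)%N.
Proof.
move=> nreg; apply: contrapT => /forallNP noex; apply: nreg.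
exists (max_degree G) => x; apply/eqP; rewrite eqn_leq degree_le_max leqNgt.
exact/negP.
Qed.

(** In diameter at most one, a vertex of non-maximal degree would be adjacent to all others and so
    have the largest possible degree. *)
Lemma diam_ge2 : connected_graph G -> ~ regular G -> (2 <= diam G)%N.
Proof.
move=> [_ conG] /exists_deficient[u ltu]; rewrite ltnNge; apply/negP => diam1.
have adju y : y != u -> adj u y.
  move=> yu; have /has_walkP[p [pu lp sp]] := distance_walk (conG u y).
  have := leq_trans (distance_le_diam u y) diam1; rewrite -sp.
  case: p pu lp {sp} => [|z [|//]] /=; first by move=> _ uy; rewrite uy eqxx in yu.
  by rewrite andbT => uz <-.
have : (#|G|.-1 <= degree u)%N.
  rewrite -(cardC1 u) -[in leqLHS]cardsE; apply/subset_leq_card/fintype.subsetP => y.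
  by rewrite !inE; exact: adju.
have cG : (0 < #|G|)%N by apply/card_gt0P; exists u.
have := max_degree_lt_card cG; lia.
Qed.

(** * Dirichlet energy and Green's identity *)

Section Energy.
Variable R : realFieldType.
Implicit Types f : G -> R.

Lemma sum_adj_const x (c : R) : \sum_(z | adj x z) c = (degree x)%:R * c.
Proof.
rewrite sumr_const mulr_natl /degree; congr (_ *+ _).
by apply: eq_card => z; rewrite !inE.
Qed.

Lemma sum_adj_exchange (F : G -> G -> R) :
  \sum_x \sum_(z | adj x z) F x z = \sum_x \sum_(z | adj x z) F z x.
Proof.
rewrite (exchange_big_dep predT) //=; apply: eq_bigr => z _.
by apply: eq_bigl => x; rewrite adj_sym.
Qed.

(** The sum runs over ordered pairs, so every edge counts twice; this is the source of the later
    divisions by 2. *)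
Definition dirichlet f : R := \sum_x \sum_(z | adj x z) (f x - f z) ^+ 2.

Lemma sum_laplacian (c : R) f :
  \sum_x (c * f x - \sum_(z | adj x z) f z) = \sum_x (c - (degree x)%:R) * f x.
Proof.
rewrite sumrB (sum_adj_exchange (fun _ z => f z)) -sumrB.
by apply: eq_bigr => x _; rewrite sum_adj_const mulrBl.
Qed.

(** Green's identity for [c - A]: the degree deficiencies act as a potential, and the edges
    contribute their energy. *)
Lemma laplacian_form (c : R) f :
  \sum_x f x * (c * f x - \sum_(z | adj x z) f z) =
  \sum_x (c - (degree x)%:R) * f x ^+ 2 + dirichlet f / 2.
Proof.
have dE : dirichlet f = 2 * \sum_x ((degree x)%:R * f x ^+ 2 - f x * \sum_(z | adj x z) f z).
  rewrite /dirichlet.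
  have -> : \sum_x \sum_(z | adj x z) (f x - f z) ^+ 2 =
     \sum_x \sum_(z | adj x z) (f x ^+ 2 - f x * f z)
     + \sum_x \sum_(z | adj x z) (f z ^+ 2 - f z * f x).
    rewrite -big_split; apply: eq_bigr => x _; rewrite -big_split /=.
    by apply: eq_bigr => z _; ring.
  rewrite (sum_adj_exchange (fun x z => f z ^+ 2 - f z * f x)) -mulr2n -[LHS]mulr_natl.
  by congr (_ * _); apply: eq_bigr => x _; rewrite sumrB sum_adj_const mulr_sumr.
rewrite dE mulrC mulKf ?pnatr_eq0// -big_split.
by apply: eq_bigr => x _ /=; ring.
Qed.

Fixpoint path_energy f x p : R :=
  if p is z :: q then (f x - f z) ^+ 2 + path_energy f z q else 0.

Lemma path_energy_ge0 f x p : 0 <= path_energy f x p.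
Proof. by elim: p x => //= z q IHq x; rewrite addr_ge0 ?sqr_ge0. Qed.

(** As the vertices are distinct, the sum [S] over ordered pairs of path vertices is part of the
    Dirichlet sum, and it contains each path edge in both orientations. *)
Lemma path_energy_le f x p : path (@adj G) x p -> uniq (x :: p) ->
  path_energy f x p <= dirichlet f / 2.
Proof.
pose F u v := if adj u v then (f u - f v) ^+ 2 else 0.
have F_ge0 u v : 0 <= F u v by rewrite /F; case: ifP => // _; apply: sqr_ge0.
pose S s := \sum_(u <- s) \sum_(v <- s) F u v.
have dirE : dirichlet f = \sum_u \sum_v F u v.
  by apply: eq_bigr => u _; rewrite big_mkcond.
have le_S s : uniq s -> S s <= dirichlet f.
  move=> us; rewrite /S dirE big_uniq //=.
  have sub (H : G -> R) : (forall u, 0 <= H u) -> \sum_(u in s) H u <= \sum_u H u.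
    by move=> H0; rewrite [leRHS](bigID (mem s)) /= lerDl sumr_ge0.
  apply: le_trans (sub _ _); last by move=> u; apply: sumr_ge0.
  by apply: ler_sum => u _; rewrite big_uniq //=; apply: sub.
move=> xp uxp; rewrite ler_pdivlMr ?ltr0n//; apply: le_trans (le_S _ uxp).
elim: p x xp {uxp} => [|z q IHq] x /=.
  by move=> _; rewrite mul0r /S; do 2! apply: sumr_ge0 => ? _.
move=> /andP[xz zq]; have {IHq} IH := IHq z zq.
have SE : S [:: x, z & q] = F x x + \sum_(v <- z :: q) F x v
    + \sum_(u <- z :: q) F u x + S (z :: q).
  rewrite /S big_cons [\sum_(v <- [:: x, z & q]) F x v]big_cons -[RHS]addrA.
  congr (_ + _); rewrite -big_split; apply: eq_bigr => u _.
  by rewrite big_cons.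
have Fxz : F x z = (f x - f z) ^+ 2 by rewrite /F xz.
have Fzx : F z x = (f x - f z) ^+ 2 by rewrite /F adj_sym xz -sqrrN opprB.
have s1 : 0 <= \sum_(v <- q) F x v by apply: sumr_ge0.
have s2 : 0 <= \sum_(v <- q) F v x by apply: sumr_ge0.
have := F_ge0 x x.
rewrite SE big_cons [\sum_(u <- z :: q) F u x]big_cons Fxz Fzx.
set e := (_ ^+ 2); nra.
Qed.

(* Cauchy-Schwarz along the path, with the endpoint joined to the ground by one more edge. *)
Lemma sqr_le_path_energy f x p :
  f x ^+ 2 <= (size p).+1%:R * (f (last x p) ^+ 2 + path_energy f x p).
Proof.
elim: p x => [|z q IHq] x /=; first by rewrite addr0 mul1r.
set k : R := (size q).+1%:R in IHq *.
have k_gt0 : 0 < k by rewrite ltr0n.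
have -> : (size q).+2%:R = k + 1 by rewrite -[in LHS]addn1 natrD.
have {IHq} := IHq z; set T := f (last z q) ^+ 2; set E := path_energy f z q.
set a := f x; set b := f z => le_b.
have amgm : 2 * b * (a - b) <= b ^+ 2 / k + k * (a - b) ^+ 2.
  rewrite -subr_ge0.
  have -> : b ^+ 2 / k + k * (a - b) ^+ 2 - 2 * b * (a - b) =
     (b - k * (a - b)) ^+ 2 / k by field; rewrite gt_eqF.
  by rewrite divr_ge0 ?sqr_ge0// ltW.
have le_bk : b ^+ 2 / k <= T + E by rewrite ler_pdivrMr // mulrC.
have -> : a ^+ 2 = b ^+ 2 + 2 * b * (a - b) + (a - b) ^+ 2 by ring.
have -> : (k + 1) * (T + ((a - b) ^+ 2 + E)) =
  k * (T + E) + (T + E) + (k * (a - b) ^+ 2 + (a - b) ^+ 2) by ring.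
rewrite -!addrA lerD // !addrA lerD2r.
exact: le_trans amgm (lerD le_bk (lexx _)).
Qed.

End Energy.

End Graph.

(** * Lower bound for the rate of a subsolution *)

Section Subsolution.
Variables (G : sgraph) (R : realFieldType) (mu : R) (y : G -> R) (s : G).
Local Notation Delta := ((max_degree G)%:R : R).
Local Notation n := (#|G|%:R : R).
Local Notation D := ((diam G)%:R : R).
Hypothesis conG : connected_graph G.
Hypothesis irrG : ~ regular G.
Hypothesis y_ge0 : forall x, 0 <= y x.
Hypothesis y_le1 : forall x, y x <= 1.
Hypothesis ys : y s = 1.
Hypothesis sub_y : forall x, Delta * y x - \sum_(z | adj x z) y z <= mu * y x.

Let deg_le (x : G) : (degree x)%:R <= Delta.
Proof. by rewrite ler_nat degree_le_max. Qed.

Lemma sum_adj_le x w : adj x w ->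
  \sum_(z | adj x z) y z <= y w + (Delta - 1).
Proof.
move=> xw; have : 1 - y w <= \sum_(z | adj x z) (1 - y z).
  by rewrite (bigD1 w) //= lerDl sumr_ge0 // => z _; rewrite subr_ge0.
by rewrite sumrB sum_adj_const mulr1; have := deg_le x; lra.
Qed.

Lemma subsolution_rate_ge0 : 0 <= mu.
Proof.
have := sub_y s; rewrite ys !mulr1; apply: le_trans; rewrite subr_ge0.
apply: le_trans (deg_le s); rewrite -[leRHS]mulr1 -sum_adj_const.
by apply: ler_sum.
Qed.

Lemma sum_deficiency_le : \sum_x (Delta - (degree x)%:R) * y x <= mu * n.
Proof.
rewrite -sum_laplacian; apply: le_trans (ler_sum _ (fun x _ => sub_y x)) _.
rewrite -mulr_sumr ler_wpM2l ?subsolution_rate_ge0//.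
by apply: le_trans (ler_sum _ (fun x _ => y_le1 x)) _; rewrite sumr_const.
Qed.

Section DeficientVertex.
Variable u : G.
Hypothesis def_u : (degree u < max_degree G)%N.

(** Degrees are integers, so the deficiency at [u] is at least one; all other terms are
    nonnegative. *)
Lemma deficiency_ge (g : G -> R) : (forall x, 0 <= g x) ->
  g u <= \sum_x (Delta - (degree x)%:R) * g x.
Proof.
move=> g0; rewrite (bigD1 u) //= -[leLHS]addr0 lerD //; last first.
  by apply: sumr_ge0 => x _; rewrite mulr_ge0 // subr_ge0.
by rewrite ler_peMl // lerBrDr addrC natr1 ler_nat.
Qed.

Lemma deficient_le : y u <= mu * n.
Proof. exact: le_trans (deficiency_ge y_ge0) sum_deficiency_le. Qed.

(** The subsolution inequality is tested against [y]. Bounding [y] by 1 only away from [u] gives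
    [n - 1] in place of [n], and this saving makes the final estimate strict. *)
Lemma energy_le : y u ^+ 2 + dirichlet y / 2 <= mu * (n - 1 + y u ^+ 2).
Proof.
apply: (@le_trans _ _ (mu * \sum_x y x ^+ 2)).
  apply: (@le_trans _ _ (\sum_x y x * (Delta * y x - \sum_(z | adj x z) y z))).
    by rewrite laplacian_form lerD2r (deficiency_ge (fun x => sqr_ge0 (y x))).
  rewrite mulr_sumr; apply: ler_sum => x _.
  by rewrite expr2 mulrCA ler_wpM2l.
rewrite ler_wpM2l ?subsolution_rate_ge0// (bigD1 u) //= addrC lerD2r.
apply: (@le_trans _ _ (\sum_(x | x != u) 1)).
  by apply: ler_sum => x _; rewrite expr_le1.
rewrite sumr_const lerBrDr natr1 ler_nat.
apply: proper_card; apply/fintype.properP; split; first exact: subset_predT.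
by exists u; rewrite // unfold_in /= eqxx.
Qed.

(* The maximum principle at [s] makes [y] at least [1 - mu] at the neighbours of [s],
   so that a shortest path to [u] may be started one step later. *)
Lemma near_max_path : exists w q, [/\ path (@adj G) w q, uniq (w :: q),
  last w q = u, (size q < diam G)%N & 1 - mu <= y w].
Proof.
have mu0 := subsolution_rate_ge0.
have /has_walkP[p' [sp' lp' szp']] := distance_walk (conG.2 s u).
have := distance_le_diam s u; rewrite -szp'.
case/shortenP: sp' lp' => p sp up subp lp le_p'.
have le_p : (size p <= diam G)%N.
  by apply: leq_trans le_p'; case/andP: up => _ /uniq_leq_size; apply.
case: p sp up lp le_p {subp} => [|w q] /=.
  move=> _ _ su _; exists s, [::]; split=> //=.
    by have := diam_ge2 conG irrG; lia.
  by rewrite ys; lra.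
move=> /andP[sw wq] /andP[_ uq] lq szq; exists w, q; split=> //.
have := sub_y s; have := sum_adj_le sw; rewrite ys; lra.
Qed.

End DeficientVertex.

Lemma subsolution_rate_gt : 1 / (#|G| * diam G)%:R < mu.
Proof.
have [u def_u] := exists_deficient irrG.
have mu0 := subsolution_rate_ge0.
have D2 := diam_ge2 conG irrG.
have n_gt := max_degree_lt_card conG.1.
have Delta_gt0 : 1 <= Delta by rewrite ler1n (leq_ltn_trans _ def_u).
have n_ge : Delta + 1 <= n by rewrite natr1 ler_nat.
rewrite ltNge natrM ler_pdivlMr ?mulr_gt0 ?ltr0n ?conG.1 ?(ltnW D2)//.
apply/negP => le1.
have yu := deficient_le def_u; have yu0 := y_ge0 u.
have [w [q [wq uq lq szq yw]]] := near_max_path def_u.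
have [D3|] := ltnP 2 (diam G).
  have D3r : 3 <= D by rewrite ler_nat.
  have yw2 : (1 - mu) ^+ 2 <= D * (mu * (n - 1 + y u ^+ 2)).
    apply: (@le_trans _ _ (y w ^+ 2)).
      rewrite ler_sqr ?nnegrE //; nra.
    apply: le_trans (sqr_le_path_energy y w q) _; rewrite lq.
    have e0 : 0 <= y u ^+ 2 + path_energy y w q.
      by rewrite addr_ge0 ?sqr_ge0 ?path_energy_ge0.
    apply: (@le_trans _ _ (D * (y u ^+ 2 + path_energy y w q))).
      by rewrite ler_wpM2r // ler_nat.
    rewrite ler_wpM2l ?ler0n//; apply: le_trans (energy_le def_u).
    by rewrite lerD2l path_energy_le.
  have mun : mu * n <= 1 / 3 by nra.
  have yu2 : y u ^+ 2 <= 1 / 9 by nra.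
  have Dmu : 0 <= D * mu by rewrite mulr_ge0 ?ler0n.
  (* Here [D * mu * n <= 1], and [1 - y u ^ 2] is at least 8/9. *)
  have : (1 - mu) ^+ 2 <= 1 - 8 / 9 * (D * mu).
    apply: le_trans yw2 _; nra.
  (* Since [8 / 9 * D] exceeds 2, the last bound forces [mu = 0], which [yw2] excludes. *)
  nra.
rewrite leq_eqVlt ltnNge D2 orbF => /eqP D2E.
rewrite D2E in le1 szq.
have mun : mu * n <= 1 / 2 by lra.
(* In diameter two, [w] is either [u] itself or a neighbour of [u]. The first case fails because
   [y u <= 1 / 2] while [1 - mu] is larger. *)
case: q wq lq szq {uq} => [|z [|//]] /=.
  move=> _ wu _; rewrite wu in yw; nra.
rewrite andbT => wz zu _; rewrite zu in wz.
have := sub_y w; have := sum_adj_le wz => h1 h2.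
have h3 : (Delta - mu) * y w <= y u + (Delta - 1) by lra.
have mu_le : mu <= 1 / 2 by nra.
have h4 : (Delta - mu) * (1 - mu) <= (Delta - mu) * y w.
  by rewrite ler_wpM2l //; lra.
have h5 : mu * (Delta + 1) <= mu * n by rewrite ler_wpM2l.
have mu2 : 0 <= mu * mu by rewrite mulr_ge0.
(* The inequalities give [1 - mu * (Delta + 1) + mu ^ 2 <= y u <= 1 / 2] with
   [mu * (Delta + 1) <= 1 / 2], leaving no room for [mu ^ 2]. At [mu = 0] they read
   [1 <= y u <= 0]. *)
have mu20 : mu * mu = 0 by lra.
have /eqP := mu20; rewrite mulf_eq0 orbb => /eqP mu_eq0.
by rewrite mu_eq0 in yu h3 h4 *; lra.
Qed.

End Subsolution.

(** * From the adjacency matrix to functions on vertices *)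

Section GraphSpectrum.
Variables (R : realType) (G : sgraph).

Lemma sum_adjacency_mx (F : G -> R) (x : G) :
  \sum_i F (enum_val i) * adjacency_mx G R i (enum_rank x) = \sum_(z | adj x z) F z.
Proof.
rewrite (reindex _ (onW_bij _ (@enum_rank_bij G))) /= [RHS]big_mkcond /=.
apply: eq_bigr => z _; rewrite mxE !enum_rankK adj_sym.
by case: adj; rewrite ?mulr1 ?mulr0.
Qed.

Lemma graph_rayleigh (f : G -> R) : (0 < #|G|)%N ->
  \sum_x f x * \sum_(z | adj x z) f z <= graph_spectral_radius R G * \sum_x f x ^+ 2.
Proof.
move=> G_gt0; pose v : 'rV[R]_#|G| := \row_j f (enum_val j).
have symA : (adjacency_mx G R)^T = adjacency_mx G R.
  by apply/matrixP => i j; rewrite !mxE adj_sym.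
have := rayleigh_le_spectral_radius v G_gt0 symA; congr (_ <= _ * _).
  rewrite mxE (reindex _ (onW_bij _ (@enum_rank_bij G))) /=.
  apply: eq_bigr => x _; rewrite mxE [v^T _ _]mxE [v _ _]mxE enum_rankK mulrC.
  rewrite -sum_adjacency_mx; congr (_ * _).
  by apply: eq_bigr => i _; rewrite [v _ _]mxE.
rewrite mxE (reindex _ (onW_bij _ (@enum_rank_bij G))) /=.
by apply: eq_bigr => x _; rewrite !mxE enum_rankK expr2.
Qed.

(** The triangle inequality in the eigenvector equation. It applies to any complex eigenvalue and
    takes the place of Perron-Frobenius. *)
Lemma eigenvector_norm_subharmonic (v : 'rV[R[i]]_#|G|) (a : R[i]) (x : G) :
  v *m map_mx (real_complex R) (adjacency_mx G R) = a *: v ->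
  normc a * normc (v 0 (enum_rank x)) <= \sum_(z | adj x z) normc (v 0 (enum_rank z)).
Proof.
move=> /matrixP/(_ 0 (enum_rank x)); rewrite mxE [RHS]mxE => /(congr1 Num.norm).
rewrite [RHS]normrM ![in RHS]normr_normc -[RHS]rmorphM => vE.
pose AC := map_mx (real_complex R) (adjacency_mx G R).
rewrite -lecR; apply: (le_trans (y := `|\sum_i v 0 i * AC i (enum_rank x)|)).
  by rewrite vE lexx.
apply: le_trans (ler_norm_sum _ _ _) _.
rewrite -(sum_adjacency_mx (fun z => normc (v 0 (enum_rank z)))) rmorph_sum /=.
apply: ler_sum => i _; rewrite normrM normr_normc enum_valK rmorphM /=.
by rewrite /AC mxE [adjacency_mx _ _ _ _]mxE ger0_norm // lecR ler0n.
Qed.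

End GraphSpectrum.

Lemma gap_constant_1 (R : realType) : gap_constant (1 : R).
Proof.
move=> G conG irrG; rewrite /graph_spectral_radius.
have [a /eigenvalueP[v va v0] [-> _]] :=
  spectral_radius_attained (adjacency_mx G R) conG.1.
pose f x := normc (v 0 (enum_rank x)).
have f_ge0 x : 0 <= f x by rewrite -lecR -normr_normc normr_ge0.
have enumG : enum G != [::] by rewrite -size_eq0 -cardE -lt0n conG.1.
have [s _ s_max] := seq_argmax f enumG.
have fs_gt0 : 0 < f s.
  rewrite lt_neqAle f_ge0 andbT eq_sym; apply: contraNneq v0 => fs0.
  apply/eqP/rowP => i; rewrite mxE -(enum_valK i).
  apply: ComplexField.Normc.eq0_normc; apply/eqP; rewrite eq_le -[normc _]/(f _).
  by rewrite f_ge0 -fs0 s_max ?mem_enum.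
(* Dividing the moduli by their maximum yields a subsolution with value 1 at [s] and rate
   [Delta - |a|]. *)
apply: (@subsolution_rate_gt G R _ (fun x => f x / f s) s) => //.
- by move=> x; rewrite divr_ge0.
- by move=> x; rewrite ler_pdivrMr // mul1r s_max ?mem_enum.
- by rewrite divff // gt_eqF.
move=> x; rewrite -mulr_suml mulrA -mulrBl [leRHS]mulrA ler_wpM2r ?invr_ge0 //.
by rewrite mulrBl lerD2l lerN2 eigenvector_norm_subharmonic.
Qed.

(** * Joining two rooted graphs under a new root *)

Record rooted_graph := RootedGraph { rooted_sgraph :> sgraph; base : rooted_sgraph }.

Lemma big_option (V : Type) (idx : V) (op : Monoid.com_law idx) (T : finType)
    (F : option T -> V) :
  \big[op/idx]_x F x = op (F None) (\big[op/idx]_x F (Some x)).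
Proof.
rewrite (bigD1 None) //=; congr (op _ _).
rewrite (reindex_omap Some id) /=; last by case.
by apply: eq_bigl => x; rewrite eqxx.
Qed.

Section Join.
Variables G H : rooted_graph.

(** [None] is the new root, attached by a bridge to each old base; iteration builds both the binary
    tree and the spine. *)
Definition join_adj (x y : option (G + H)) : bool :=
  match x, y with
  | None, Some (inl a) | Some (inl a), None => a == base G
  | None, Some (inr b) | Some (inr b), None => b == base H
  | Some (inl a), Some (inl a') => adj a a'
  | Some (inr b), Some (inr b') => adj b b'
  | _, _ => false
  end.

Lemma join_adj_sym : symmetric join_adj.
Proof. by move=> [[a|b]|] [[a'|b']|] //=; exact: adj_sym. Qed.

Lemma join_adj_irrefl : irreflexive join_adj.
Proof. by move=> [[a|b]|] //=; exact: adj_irrefl. Qed.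

Definition join : rooted_graph :=
  @RootedGraph (SGraph join_adj_sym join_adj_irrefl) None.

Lemma big_join (V : Type) (idx : V) (op : Monoid.com_law idx) (F : join -> V) :
  \big[op/idx]_x F x = op (F None)
    (op (\big[op/idx]_(a : G) F (Some (inl a))) (\big[op/idx]_(b : H) F (Some (inr b)))).
Proof. by rewrite big_option big_sumType. Qed.

Lemma card_join : #|join| = (#|G| + #|H|).+1.
Proof. by rewrite card_option card_sum. Qed.

Lemma join_walk_inl (a a' : G) n : has_walk a a' n ->
  has_walk (Some (inl a) : join) (Some (inl a')) n.
Proof.
move=> /has_walkP[p [ap <- <-]]; apply/has_walkP.
exists [seq Some (inl b) : join | b <- p]; rewrite size_map; split=> //.
  by elim: p a ap => //= b p IHp a /andP[-> /IHp].
exact: (last_map (fun b : G => Some (inl b) : join)).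
Qed.

Lemma join_walk_inr (b b' : H) n : has_walk b b' n ->
  has_walk (Some (inr b) : join) (Some (inr b')) n.
Proof.
move=> /has_walkP[p [bp <- <-]]; apply/has_walkP.
exists [seq Some (inr a) : join | a <- p]; rewrite size_map; split=> //.
  by elim: p b bp => //= a p IHp b /andP[-> /IHp].
exact: (last_map (fun a : H => Some (inr a) : join)).
Qed.

Lemma join_walk_root_inl (a : G) n : has_walk (base G) a n ->
  has_walk (None : join) (Some (inl a)) n.+1.
Proof.
move=> /join_walk_inl; rewrite -add1n; apply: has_walk_cat.
by apply: has_walk1; exact: eqxx.
Qed.

Lemma join_walk_root_inr (b : H) n : has_walk (base H) b n ->
  has_walk (None : join) (Some (inr b)) n.+1.
Proof.
move=> /join_walk_inr; rewrite -add1n; apply: has_walk_cat.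
by apply: has_walk1; exact: eqxx.
Qed.

Lemma dirichlet_join (R : realFieldType) (f : join -> R) :
  dirichlet f = dirichlet (fun a : G => f (Some (inl a)))
    + dirichlet (fun b : H => f (Some (inr b)))
    + 2 * ((f None - f (Some (inl (base G)))) ^+ 2
           + (f None - f (Some (inr (base H)))) ^+ 2).
Proof.
have sumE (x : join) : \sum_(z | adj x z) (f x - f z) ^+ 2 =
    (if adj x None then (f x - f None) ^+ 2 else 0)
    + (\sum_(a : G) (if adj x (Some (inl a)) then (f x - f (Some (inl a))) ^+ 2 else 0)
       + \sum_(b : H) (if adj x (Some (inr b)) then (f x - f (Some (inr b))) ^+ 2 else 0)).
  by rewrite big_mkcond big_join.
rewrite {1}/dirichlet (eq_bigr _ (fun x _ => sumE x)) big_join /= add0r.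
rewrite -2!big_mkcond !big_pred1_eq !big_split /= -2!big_mkcond !big_pred1_eq.
have dirichletE (K : sgraph) (g : K -> R) : dirichlet g =
    \sum_x \sum_z if adj x z then (g x - g z) ^+ 2 else 0.
  by apply: eq_bigr => x _; rewrite big_mkcond.
have zero (I J : finType) : \sum_(i : I) \sum_(j : J) (0 : R) = 0.
  by rewrite big1 // => i _; rewrite big1.
rewrite !zero !dirichletE; ring.
Qed.

Lemma degree_sum (K : sgraph) (x : K) : degree x = (\sum_y adj x y)%N.
Proof. by rewrite /degree -sum1_card big_mkcond; apply: eq_bigr => y _; rewrite inE; case: adj. Qed.

Lemma degree_join_root : degree (None : join) = 2%N.
Proof.
rewrite degree_sum big_join /=.
rewrite (bigD1 (base G)) //= eqxx big1 ?addn0 => [|a /negPf ->//].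
by rewrite (bigD1 (base H)) //= eqxx big1 // => b /negPf ->.
Qed.

Lemma degree_join_inl (a : G) :
  degree (Some (inl a) : join) = ((a == base G) + degree a)%N.
Proof. by rewrite !degree_sum big_join /= big1_eq addn0. Qed.

Lemma degree_join_inr (b : H) :
  degree (Some (inr b) : join) = ((b == base H) + degree b)%N.
Proof. by rewrite !degree_sum big_join /= big1_eq. Qed.

End Join.

(** * Degrees, eccentricity and diameter of joins *)

Definition rooted_cubic (G : rooted_graph) : Prop :=
  degree (base G) = 2%N /\ forall x, x != base G -> degree x = 3%N.

(** This bound and the next are witnessed by walks, which can be transported into a [join] and
    concatenated there. *)
Definition ecc_le (G : rooted_graph) (e : nat) : Prop :=
  forall x, exists2 m, has_walk (base G) x m & (m <= e)%N.

Definition diam_bound (G : sgraph) (d : nat) : Prop :=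
  forall x y : G, exists2 m, has_walk x y m & (m <= d)%N.

(** Each old base gains one edge and reaches degree three, while the new root has degree two. *)
Lemma rooted_cubic_join G H :
  rooted_cubic G -> rooted_cubic H -> rooted_cubic (join G H).
Proof.
move=> [rG cG] [rH cH]; split; first exact: degree_join_root.
move=> [[a|b]|//] _; rewrite (degree_join_inl, degree_join_inr).
  by have [->|/cG->//] := eqVneq; rewrite rG.
by have [->|/cH->//] := eqVneq; rewrite rH.
Qed.

Lemma ecc_le_mono (G : rooted_graph) e e' : (e <= e')%N -> ecc_le G e -> ecc_le G e'.
Proof. by move=> ee' eG x; have [m ? me] := eG x; exists m; last exact: leq_trans ee'. Qed.

Lemma diam_bound_mono (G : sgraph) d d' :
  (d <= d')%N -> diam_bound G d -> diam_bound G d'.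
Proof. by move=> dd' dG x y; have [m ? md] := dG x y; exists m; last exact: leq_trans dd'. Qed.

Lemma ecc_le_join G H e : ecc_le G e -> ecc_le H e -> ecc_le (join G H) e.+1.
Proof.
move=> eG eH [[a|b]|]; last by exists 0%N => //; exact: has_walk0.
  by have [m am me] := eG a; exists m.+1 => //; exact: join_walk_root_inl.
by have [m bm me] := eH b; exists m.+1 => //; exact: join_walk_root_inr.
Qed.

Lemma ecc_le_diam_bound (G : rooted_graph) e : ecc_le G e -> diam_bound G (e + e).
Proof.
move=> eG x y; have [m xm me] := eG x; have [m' ym m'e] := eG y.
by exists (m + m')%N; [exact: has_walk_cat (has_walk_sym xm) ym | exact: leq_add].
Qed.

(** Only walks between the two halves are new, and they pass through the root. A long spine thus
    enters the diameter once instead of twice. *)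
Lemma diam_bound_join G H e e' d : (e + e' + 2 <= d)%N ->
  ecc_le G e -> ecc_le H e' -> diam_bound G d -> diam_bound H d ->
  diam_bound (join G H) d.
Proof.
move=> le_d eG eH dG dH.
have to_inl a : exists2 m, has_walk (None : join G H) (Some (inl a)) m & (m <= e.+1)%N.
  by have [m am me] := eG a; exists m.+1 => //; exact: join_walk_root_inl.
have to_inr b : exists2 m, has_walk (None : join G H) (Some (inr b)) m & (m <= e'.+1)%N.
  by have [m bm me] := eH b; exists m.+1 => //; exact: join_walk_root_inr.
move=> [[a|b]|] [[a'|b']|].
- by have [m am md] := dG a a'; exists m => //; exact: join_walk_inl.
- have [m am me] := to_inl a; have [m' bm m'e] := to_inr b'.
  by exists (m + m')%N; [exact: has_walk_cat (has_walk_sym am) bm | lia].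
- by have [m am me] := to_inl a; exists m; [exact: has_walk_sym | lia].
- have [m am me] := to_inl a'; have [m' bm m'e] := to_inr b.
  by exists (m' + m)%N; [exact: has_walk_cat (has_walk_sym bm) am | lia].
- by have [m am md] := dH b b'; exists m => //; exact: join_walk_inr.
- by have [m am me] := to_inr b; exists m; [exact: has_walk_sym | lia].
- by have [m am me] := to_inl a'; exists m; [| lia].
- by have [m am me] := to_inr b'; exists m; [| lia].
- by exists 0%N; [exact: has_walk0 | ].
Qed.

(* K4 with one edge subdivided by the base vertex [0]. *)
Definition leaf_edges : seq (nat * nat) :=
  [:: (0, 1); (0, 2); (1, 3); (1, 4); (2, 3); (2, 4); (3, 4)]%N.

Definition leaf_adj (i j : 'I_5) : bool :=
  ((i : nat, j : nat) \in leaf_edges) || ((j : nat, i : nat) \in leaf_edges).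

Lemma leaf_adj_sym : symmetric leaf_adj.
Proof. by move=> i j; rewrite /leaf_adj orbC. Qed.

Lemma leaf_adj_irrefl : irreflexive leaf_adj.
Proof. by case=> [[|[|[|[|[|]]]]]]. Qed.

Definition leaf : rooted_graph := @RootedGraph (SGraph leaf_adj_sym leaf_adj_irrefl) ord0.

Lemma rooted_cubic_leaf : rooted_cubic leaf.
Proof.
split; first by rewrite degree_sum !big_ord_recl big_ord0.
by case=> [[|[|[|[|[|]]]]]] // ? _; rewrite degree_sum !big_ord_recl big_ord0.
Qed.

Lemma ecc_le_leaf : ecc_le leaf 2.
Proof.
have w1 (i : leaf) : leaf_adj ord0 i -> exists2 m, has_walk (base leaf) i m & (m <= 2)%N.
  by move=> ?; exists 1%N => //; exact: has_walk1.
(* Vertices 3 and 4 are reached through vertex 1, and so is the base itself, by a closed walk. *)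
have w2 (i : leaf) : leaf_adj (inord 1) i -> exists2 m, has_walk (base leaf) i m & (m <= 2)%N.
  move=> i1; exists (1 + 1)%N => //; apply: (@has_walk_cat leaf _ (inord 1 : 'I_5)).
    by apply: has_walk1; rewrite /= /leaf_adj !inordK.
  exact: has_walk1.
case=> [[|[|[|[|[|]]]]]] // ?.
- by apply: w2; rewrite /leaf_adj /= !inordK.
- exact: w1.
- exact: w1.
- by apply: w2; rewrite /leaf_adj /= !inordK.
- by apply: w2; rewrite /leaf_adj /= !inordK.
Qed.

(** * Brooms: a binary tree at the end of a spine *)

(** A complete binary tree of depth [k] with a copy of [leaf] at each end. *)
Definition blob (k : nat) : rooted_graph := iter k (fun G => join G G) leaf.

(** Each step adds a spine vertex carrying one [leaf]; the base is the end of the spine away from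
    the tree. *)
Definition broom (k l : nat) : rooted_graph := iter l (fun G => join G leaf) (blob k).

Lemma rooted_cubic_broom k l : rooted_cubic (broom k l).
Proof.
elim: l => [|l IHl] /=; last exact: rooted_cubic_join IHl rooted_cubic_leaf.
by elim: k => [|k IHk]; [exact: rooted_cubic_leaf | exact: rooted_cubic_join].
Qed.

Lemma ecc_le_blob k : ecc_le (blob k) (k + 2).
Proof. by elim: k => [|k IHk]; [exact: ecc_le_leaf | rewrite addSn; exact: ecc_le_join]. Qed.

Lemma ecc_le_broom k l : ecc_le (broom k l) (l + k + 2).
Proof.
elim: l => [|l IHl]; first exact: ecc_le_blob.
by rewrite !addSn; apply: ecc_le_join => //; apply: ecc_le_mono ecc_le_leaf; lia.
Qed.

Lemma diam_bound_broom k l : diam_bound (broom k l) (l + 2 * k + 10).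
Proof.
elim: l => [|l IHl].
  by apply: diam_bound_mono (ecc_le_diam_bound (@ecc_le_blob k)); lia.
apply: (diam_bound_join _ (@ecc_le_broom k l) ecc_le_leaf); first lia.
  by apply: diam_bound_mono IHl; lia.
by apply: diam_bound_mono (ecc_le_diam_bound ecc_le_leaf); lia.
Qed.

Lemma connected_broom k l : connected_graph (broom k l).
Proof.
split; first by apply/card_gt0P; exists (base _).
move=> x y; have [m /has_walkP[p [xp <- _]] _] := @diam_bound_broom k l x y.
by apply/connectP; exists p.
Qed.

Lemma card_blob_ge k : (2 ^ k <= #|blob k|)%N.
Proof.
elim: k => [|k IHk]; first by rewrite card_ord.
by rewrite expnS (card_join (blob k) (blob k)); move: IHk; lia.
Qed.

Lemma card_broom k l : #|broom k l| = (#|blob k| + 6 * l)%N.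
Proof.
elim: l => [|l IHl]; first by rewrite addn0.
(* The six new vertices are the five of [leaf] and the root. *)
by rewrite (card_join (broom k l) leaf) IHl card_ord; lia.
Qed.

Lemma rooted_cubic_nonroot (G : rooted_graph) :
  rooted_cubic G -> exists x : G, degree x = 3%N.
Proof.
move=> [rG cG]; have [x /cG xdeg|no] := pickP (predC1 (base G)); first by exists x.
by have := degree_lt_card (base G); have := cardC1 (base G); rewrite rG (eq_card0 no); lia.
Qed.

Lemma rooted_cubic_irregular (G : rooted_graph) : rooted_cubic G -> ~ regular G.
Proof.
move=> cubG [d regG]; have [x] := rooted_cubic_nonroot cubG.
by rewrite regG -(regG (base G)) cubG.1.
Qed.

Lemma max_degree_rooted_cubic (G : rooted_graph) : rooted_cubic G -> max_degree G = 3%N.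
Proof.
move=> cubG; have [x x3] := rooted_cubic_nonroot cubG.
apply/eqP; rewrite eqn_leq -{2}x3 degree_le_max andbT.
apply/bigmax_leqP => y _; have [->|/cubG.2 ->//] := eqVneq y (base G).
by rewrite cubG.1.
Qed.

(** The test function is 1 at the base, rises by one along each of the [l] spine edges and equals
    [l + 1] on the blob. The shift [c] strengthens the induction, whose step adds 1 to the function
    on the old broom. *)
Lemma dirichlet_broom (R : realFieldType) k l : exists f : broom k l -> R,
  [/\ f (base (broom k l)) = 1, dirichlet f = 2 * l%:R
    & forall c, 0 <= c -> #|blob k|%:R * (l%:R + 1 + c) ^+ 2 <= \sum_x (f x + c) ^+ 2].
Proof.
elim: l => [|l [f [f1 df sf]]].
  exists (fun=> 1); split=> // [|c _].
    rewrite mulr0 /dirichlet big1 // => x _; rewrite big1 // => z _.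
    by rewrite subrr expr0n.
  by rewrite sumr_const add0r mulr_natl.
exists (fun x : join (broom k l) leaf => if x is Some (inl a) then f a + 1 else 1); split=> //.
  rewrite dirichlet_join f1.
  have -> : dirichlet (fun a => f a + 1) = 2 * l%:R.
    by rewrite -df; apply: eq_bigr => x _; apply: eq_bigr => z _; ring.
  have -> : dirichlet (fun _ : leaf => 1 : R) = 0.
    rewrite /dirichlet big1 // => x _; rewrite big1 // => z _.
    by rewrite subrr expr0n.
  by rewrite -(natr1 l); ring.
move=> c c0; have /sf : 0 <= 1 + c by rewrite addr_ge0.
have -> : l.+1%:R + 1 + c = l%:R + 1 + (1 + c) :> R by rewrite -natr1; ring.
move=> /le_trans; apply; rewrite big_join /=.
under eq_bigr => a _ do rewrite addrA.
rewrite addrCA lerDl addr_ge0 ?sqr_ge0// sumr_ge0 // => b _; exact: sqr_ge0.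
Qed.

(** * Spectral gap of brooms *)

Section BroomGap.
Variable R : realType.

Lemma gap_rooted_cubic (c : R) (G : rooted_graph) :
  gap_constant c -> connected_graph G -> rooted_cubic G ->
  c < (#|G| * diam G)%:R * (3 - graph_spectral_radius R G).
Proof.
move=> gap_c conG cubG; have irrG := rooted_cubic_irregular cubG.
have := gap_c G conG irrG; rewrite max_degree_rooted_cubic // ltr_pdivrMr 1?mulrC //.
by rewrite ltr0n muln_gt0 conG.1 (ltnW (diam_ge2 conG irrG)).
Qed.

(** A negative gap would contradict the lower bound with constant 1. *)
Lemma broom_gap_ge0 k l : 0 <= 3 - graph_spectral_radius R (broom k l).
Proof.
have := gap_rooted_cubic (@gap_constant_1 R) (connected_broom k l) (rooted_cubic_broom k l).
apply: contraTle; rewrite -leNgt => gap_lt0.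
by apply: le_trans ler01; rewrite mulr_ge0_le0 ?ler0n // ltW.
Qed.

(** Green's identity gives [l + 1]: one from the deficient base and one per spine edge. The squared
    norm is at least [N * (l + 1)^2] from the blob alone. *)
Lemma broom_gap_le k l :
  (3 - graph_spectral_radius R (broom k l)) * (#|blob k|%:R * (l%:R + 1)) <= 1.
Proof.
have [f [f1 df sf]] := dirichlet_broom R k l.
have [rG cG] := rooted_cubic_broom k l.
have := sf 0 (lexx 0); rewrite addr0.
under [X in _ <= X -> _]eq_bigr => x _ do rewrite addr0.
set S := \sum_x _ => S_ge.
have defE : \sum_x (3 - (degree x)%:R) * f x ^+ 2 = 1.
  rewrite (bigD1 (base _)) //= rG f1 big1 => [|x /cG ->]; first by ring.
  by rewrite subrr mul0r.
have formE : 3 * S - \sum_x f x * \sum_(z | adj x z) f z = 1 + l%:R.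
  transitivity (\sum_x f x * (3 * f x - \sum_(z | adj x z) f z)).
    rewrite mulr_sumr -sumrB; apply: eq_bigr => x _; ring.
  by rewrite laplacian_form defE df; field.
have := graph_rayleigh f (connected_broom k l).1; rewrite -/S => ray.
have g0 := broom_gap_ge0 k l.
have l1 : 0 < l%:R + 1 :> R by rewrite natr1 ltr0n.
rewrite -(ler_pM2r l1) mul1r -!mulrA -expr2.
apply: le_trans (ler_wpM2l g0 S_ge) _; lra.
Qed.

Lemma broom_upper h (t : R := h.+1%:R) (G := broom (3 * h) (h.+1 ^ 2)) :
  (#|G| * diam G)%:R * (3 - graph_spectral_radius R G) <= 1 + 69 / t.
Proof.
have t1 : 1 <= t by rewrite ler1n.
pose l := (h.+1 ^ 2)%N; pose N := #|blob (3 * h)|.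
have lE : l%:R = t ^+ 2 by rewrite natrX.
(* From [h + 1 <= 2 ^ h], cubed. So [l = t^2] is negligible against [N], and the depth [3 * h]
   against [l]. *)
have N_ge : t ^+ 3 <= N%:R.
  rewrite -natrX ler_nat; apply: leq_trans (card_blob_ge _).
  by rewrite mulnC expnM leq_exp2r // ltn_expl.
have n_le : #|G|%:R <= N%:R * (1 + 6 / t).
  rewrite card_broom natrD natrM -/N lE mulrDr mulr1 lerD2l.
  rewrite mulrA ler_pdivlMr; first by nra.
  by lra.
have D_le : (diam G)%:R <= (l%:R + 1) * (1 + 9 / t).
  have := diam_le (@diam_bound_broom (3 * h) l); rewrite -(ler_nat R) => /le_trans; apply.
  rewrite 2!natrD [X in _ + X + _]natrM natrM lE.
  have -> : h%:R = t - 1 by rewrite /t -natr1 addrK.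
  have -> : (t ^+ 2 + 1) * (1 + 9 / t) = t ^+ 2 + 1 + 9 * t + 9 / t.
    by field; rewrite gt_eqF //; lra.
  have : 0 <= 9 / t by rewrite divr_ge0 //; lra.
  by move: (9 / t) => u; lra.
have it0 : 0 <= t^-1 by rewrite invr_ge0; lra.
have it1 : t^-1 <= 1 by rewrite invf_le1 //; lra.
clearbody t.
have nD_le : (#|G| * diam G)%:R <= N%:R * (l%:R + 1) * ((1 + 6 / t) * (1 + 9 / t)).
  rewrite natrM mulrACA; apply: ler_pM => //; exact: ler0n.
apply: le_trans (ler_wpM2r (broom_gap_ge0 _ _) nD_le) _.
have gap_le := broom_gap_le (3 * h) l.
rewrite mulrAC [X in X * _]mulrC.
apply: (@le_trans _ _ (1 * ((1 + 6 / t) * (1 + 9 / t)))).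
  apply: ler_wpM2r => //; nra.
(* The product is [1 + 15 / t + 54 / t^2], and [15 + 54 = 69] as [t >= 1]. *)
nra.
Qed.

End BroomGap.

Theorem proposition6p1 (R : realType) :
  (gap_constant (1 : R) /\ (forall c : R, gap_constant c -> c <= 1)) /\
  (exists G : nat -> sgraph,
     (forall h : nat, connected_graph (G h) /\ one_degree2_rest_degree3 (G h)) /\
     (fun h : nat => (#|G h| * diam (G h))%:R * (3 - graph_spectral_radius R (G h)))
       @ \oo --> (1 : R)).
Proof.
have upper_cvg : (fun h => 1 + 69 / h.+1%:R : R) @ \oo --> (1 : R).
  rewrite -[X in _ --> X](addr0 1) -(mulr0 69).
  by apply: cvgD; [exact: cvg_cst | apply: cvgM; [exact: cvg_cst | exact: cvg_harmonic]].
have broomP h c : gap_constant c ->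
    c < (#|broom (3 * h) (h.+1 ^ 2)| * diam (broom (3 * h) (h.+1 ^ 2)))%:R
      * (3 - graph_spectral_radius R (broom (3 * h) (h.+1 ^ 2))) :> R.
  by move=> gap_c; apply: gap_rooted_cubic => //;
    [exact: connected_broom | exact: rooted_cubic_broom].
split.
  split=> [|c gap_c]; first exact: gap_constant_1.
  (* A gap constant lies below every broom value, hence below the limit of their upper bounds. *)
  rewrite -(cvg_lim _ upper_cvg) //; apply: limr_ge.
    by apply/cvg_ex; exists (1 : R).
  by apply: nearW => h; apply: le_trans (broom_upper R h); apply/ltW/broomP.
exists (fun h => broom (3 * h) (h.+1 ^ 2)); split=> [h|].
  split; first exact: connected_broom.
  by exists (base _); exact: rooted_cubic_broom.
(* The constant lower bound comes from the gap constant 1 applied to brooms. *)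
apply: (squeeze_cvgr _ (cvg_cst (1 : R)) upper_cvg).
apply: nearW => h; rewrite broom_upper andbT.
by apply/ltW/broomP; exact: gap_constant_1.
Qed.
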